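(* Let $C\leq KG$ be a projector additive left group code and let $P\in\operatorname{End}_{FG}(KG)$ be an $FG$-linear projector such that $C=\operatorname{Im}(P)$. Let $I$ denote the identity map of $KG$. Then the following hold: (1) If $P^{*}=I-P$, where $P^*$ is the adjoint of $P$ with respect to $\langle\cdot,\cdot\rangle_{\mathrm{TE}}$, then $C$ is TE-self-dual. (2) If $m$ is even and $P^{*}=I-P$, where $P^*$ is the adjoint of $P$ with respect to $\langle\cdot,\cdot\rangle_{\mathrm{TH}}$, then $C$ is TH-self-dual.
   Context: $F=\mathbb{F}_q$ is a finite field, $K=\mathbb{F}_{q^m}$ is its extension of degree $m$, $G$ is a finite group, and $FG\subseteq KG$ are the group algebras; $KG$ is viewed as a left $FG$-module. An additive left group code is a left $FG$-submodule $C\leq KG$. An $FG$-linear projector is an element $P\in\operatorname{End}_{FG}(KG)$ with $P^2=P$; $C$ is a projector additive left group code if $C=\operatorname{Im}(P)$ for some $FG$-linear projector $P$. For $x=\sum_{g\in G}a_g g$ and $y=\sum_{g\in G}b_g g$ in $KG$, $\langle x,y\rangle_{\mathrm{TE}}=\operatorname{Tr}_{K/F}\left(\sum_{g\in G}a_gb_g\right)$ and, when $m$ is even, $\langle x,y\rangle_{\mathrm{TH}}=\operatorname{Tr}_{K/F}\left(\sum_{g\in G}a_g\overline{b_g}\right)$, where $\overline{b}=b^{q^{m/2}}$. Both are non-degenerate symmetric $F$-bilinear forms on $KG$. For $\star\in\{\mathrm{TE},\mathrm{TH}\}$, $C^{\perp_\star}=\{x\in KG:\langle x,c\rangle_\star=0\text{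 for all }c\in C\}$, and $C$ is $\star$-self-dual if $C=C^{\perp_\star}$. The adjoint of $T\in\operatorname{End}_{FG}(KG)$ with respect to $\langle\cdot,\cdot\rangle_\star$ is the unique $F$-linear map $T^{*}$ with $\langle Tx,y\rangle_\star=\langle x,T^{*}y\rangle_\star$ for all $x,y\in KG$. *)

(* Defs.v *)
From HB Require Import structures.
From mathcomp Require Import all_boot all_order all_fingroup all_algebra all_field.

Set Implicit Arguments.
Unset Strict Implicit.
Unset Printing Implicit Defensive.

Import GRing.Theory.
Local Open Scope ring_scope.

(* The group algebra R[G]: x stands for \sum_g (x g) g, and the product is
   convolution (unlike the pointwise product that {ffun G -> R} carries). *)
Definition group_alg (R : nzRingType) (G : finGroupType) : Type :=
  {ffun G -> R}.

Section GroupAlgebra.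
Variables (R : nzRingType) (G : finGroupType).
Local Notation RG := (group_alg R G).

HB.instance Definition _ := GRing.Zmodule.copy RG {ffun G -> R}.

Definition ga_one : RG := [ffun g : G => (g == 1%g)%:R : R].

Definition ga_mul (x y : RG) : RG :=
  [ffun g : G => \sum_(h : G) x h * y (h^-1 * g)%g].

Lemma ga_mulA : associative ga_mul.
Proof.
move=> x y z; apply/ffunP=> g; rewrite !ffunE.
under [RHS]eq_bigr => h _ do rewrite ffunE mulr_suml.
rewrite exchange_big; apply: eq_bigr => k _ /=.
rewrite ffunE mulr_sumr [RHS](reindex_inj (mulgI k)).
by apply: eq_bigr => h _; rewrite mulrA mulKg invMg mulgA.
Qed.

Lemma ga_mul1 : left_id ga_one ga_mul.
Proof.
move=> x; apply/ffunP=> g; rewrite ffunE (bigD1 1%g) //= ffunE eqxx mul1r.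
rewrite invg1 mul1g big1 ?addr0 // => h /negPf h1.
by rewrite ffunE h1 mul0r.
Qed.

Lemma ga_mulr1 : right_id ga_one ga_mul.
Proof.
move=> x; apply/ffunP=> g; rewrite ffunE (bigD1 g) //= ffunE mulVg eqxx mulr1.
rewrite big1 ?addr0 // => h hg.
by rewrite ffunE -eq_mulVg1 (negPf hg) mulr0.
Qed.

Lemma ga_mulDl : left_distributive ga_mul +%R.
Proof.
move=> x y z; apply/ffunP=> g; rewrite !ffunE -big_split.
by apply: eq_bigr => h _; rewrite ffunE mulrDl.
Qed.

Lemma ga_mulDr : right_distributive ga_mul +%R.
Proof.
move=> x y z; apply/ffunP=> g; rewrite !ffunE -big_split.
by apply: eq_bigr => h _; rewrite ffunE mulrDr.
Qed.

Lemma ga_one_neq0 : ga_one != 0.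
Proof.
apply/eqP=> /ffunP/(_ 1%g); rewrite !ffunE eqxx.
by apply/eqP; exact: oner_neq0.
Qed.

HB.instance Definition _ := GRing.Zmodule_isNzRing.Build RG
  ga_mulA ga_mul1 ga_mulr1 ga_mulDl ga_mulDr ga_one_neq0.

End GroupAlgebra.

(* K is a finite extension of F, with q = #|F| and m = \dim {:K}; the library
   alias finvect_type K of K carries the finite-field and splitting-field
   structures over F that K then has. *)
Section Codes.
Variables (F : finFieldType) (K : fieldExtType F) (G : finGroupType).
Local Notation Kf := (finvect_type K).
Local Notation q := #|F|.
Local Notation m := (\dim {:K}).
Local Notation FG := (group_alg F G).

Definition ext_group_alg : Type := group_alg Kf G.
Local Notation KG := ext_group_alg.

HB.instance Definition _ := GRing.NzRing.copy KG (group_alg Kf G).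
HB.instance Definition _ := Finite.copy KG {ffun G -> Kf}.

Definition ga_incl (a : FG) : KG := [ffun g : G => (a g)%:A : Kf].

Lemma ga_inclM a b : ga_incl (a * b) = ga_incl a * ga_incl b.
Proof.
apply/ffunP=> g; rewrite !ffunE scaler_suml.
by apply: eq_bigr => h _; rewrite !ffunE -scalerAl mul1r scalerA.
Qed.

Lemma ga_incl1 : ga_incl 1 = 1.
Proof.
by apply/ffunP=> g; rewrite !ffunE; case: eqP; rewrite ?scale1r ?scale0r.
Qed.

Lemma ga_inclD : {morph ga_incl : a b / a + b}.
Proof. by move=> a b; apply/ffunP=> g; rewrite !ffunE scalerDl. Qed.

Definition ga_scale (a : FG) (x : KG) : KG := ga_incl a * x.

Lemma ga_scaleA a b x : ga_scale a (ga_scale b x) = ga_scale (a * b) x.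
Proof. by rewrite /ga_scale ga_inclM mulrA. Qed.

Lemma ga_scale1 : left_id 1 ga_scale.
Proof. by move=> x; rewrite /ga_scale ga_incl1 mul1r. Qed.

Lemma ga_scaleDr : right_distributive ga_scale +%R.
Proof. by move=> a x y; rewrite /ga_scale mulrDr. Qed.

Lemma ga_scaleDl x : {morph ga_scale^~ x : a b / a + b}.
Proof. by move=> a b; rewrite /ga_scale ga_inclD mulrDl. Qed.

(* The canonical scalars of KG are the elements of FG, so that
   {linear KG -> KG} is End_FG(KG). *)
HB.instance Definition _ := GRing.Zmodule_isLmodule.Build FG KG
  ga_scaleA ga_scale1 ga_scaleDr ga_scaleDl.

(* The values of the trace lie in the copy 1%VS of F inside K. *)
Definition Tr (a : Kf) : Kf := galTrace 1 {:Kf} a.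

Lemma Tr_base (a : Kf) : Tr a \in 1%VS.
Proof. exact: mem_galTrace (finField_galois (sub1v _)) (memvf a). Qed.

Definition conj_half (b : Kf) : Kf := b ^+ (q ^ m./2).

Definition TE (x y : KG) : Kf := Tr (\sum_(g : G) x g * y g).

(* Only meaningful when m is even. *)
Definition TH (x y : KG) : Kf := Tr (\sum_(g : G) x g * conj_half (y g)).

Definition dual_code (B : KG -> KG -> Kf) (C : {set KG}) : {set KG} :=
  [set x | [forall c in C, B x c == 0]].

Definition self_dual (B : KG -> KG -> Kf) (C : {set KG}) : Prop :=
  C = dual_code B C.

(* T' is the adjoint of T; its F-linearity refers to the coefficientwise
   F-vector space structure of {ffun G -> K}. *)
Definition is_adjoint (B : KG -> KG -> Kf) (T T' : KG -> KG) : Prop :=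
  linear (T' : {ffun G -> Kf} -> {ffun G -> Kf}) /\
  (forall x y : KG, B (T x) y = B x (T' y)).

Definition projector (P : {linear KG -> KG}) : Prop := P \o P =1 P.

Definition additive_left_group_code (C : {set KG}) : Prop :=
  GRing.submod_closed C.

Definition projector_code (C : {set KG}) : Prop :=
  additive_left_group_code C /\
  exists P : {linear KG -> KG}, projector P /\ C = P @: [set: KG].

End Codes.

(* Main.v *)
(* If P* = I - P then B (P x) (P y) = B x (P y - P (P y)) = 0, so Im P is
   self-orthogonal; conversely, if B x (P y) = 0 for all y, then
   B (P x) y = B x (y - P y) = B x y for all y, so P x = x by nondegeneracy. *)
Require Import Defs.
From mathcomp Require Import all_boot all_order all_fingroup all_algebra all_field.

Local Open Scope ring_scope.

Import GRing.Theory.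

Section SelfDual.
Variables (F : finFieldType) (K : fieldExtType F) (G : finGroupType).
Local Notation Kf := (finvect_type K).
Local Notation KG := (ext_group_alg K G).

Lemma projector_self_dual (B : KG -> KG -> Kf) (P : {linear KG -> KG}) :
    (forall x, {morph B x : y z / y + z}) ->
    (forall y, {morph B^~ y : x z / x + z}) ->
    (forall x, (forall y, B x y = 0) -> x = 0) ->
    projector P -> is_adjoint B P (fun x => x - P x) ->
  self_dual B (P @: [set: KG]).
Proof.
move=> BDr BDl Bnd PP [_ adjP].
have B0 x : B x 0 = 0 by apply: (addrI (B x 0)); rewrite -BDr !addr0.
apply/setP=> x; rewrite inE; apply/imsetP/forall_inP.
  move=> [u _ ->] _ /imsetP[v _ ->].
  by rewrite adjP (_ : P (P v) = P v) ?subrr ?B0 //; apply: PP.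
move=> xC; exists x; rewrite ?inE //; apply/eqP; rewrite -subr_eq0; apply/eqP.
apply: Bnd => y; have xPy : B x (P y) = 0 by apply/eqP/xC/imset_f; rewrite inE.
apply: (addIr (B (P x) y)); rewrite -BDl subrK add0r adjP.
by have := BDr x (y - P y) (P y); rewrite subrK xPy addr0.
Qed.

(** By Dedekind independence of automorphisms the trace is not the zero map; rescaling by [a^-1]
    carries a [b] of nonzero trace into the range of [a * _]. *)
Lemma Tr_nondegenerate (a : Kf) : (forall b, Tr (a * b) = 0) -> a = 0.
Proof.
move=> Tra0; apply/eqP/contraT=> a0.
(* With every coefficient equal to 1, the combination of Galois automorphisms is the trace
   itself. *)
have [b _ /eqP[]] := @gal_independent_contra _ _ {:Kf}
  (mem 'Gal({:Kf} / 1)%g) (fun=> 1) 1%g (group1 _) (oner_neq0 _).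
rewrite (eq_bigr (fun y : gal_of {:Kf} => y b)) => [|y _]; last exact: mul1r.
by rewrite -[RHS](Tra0 (a^-1 * b)) mulVKf.
Qed.

(** The exponent is a power of the characteristic [p], since [#|F|] is, so this map is an iterate of
    Frobenius. *)
Lemma conj_halfD : {morph @conj_half F K : a b / a + b}.
Proof.
move=> a b; rewrite /conj_half.
have [p p_pr pF] := finPcharP F.
rewrite exprDn_pchar // (eq_pnat _ (pchar_lalg Kf)) (eq_pnat _ (pcharf_eq pF)).
have -> : #|F| = (p ^ logn p #|F|)%N by exact: (card_pprimeChar pF).
by rewrite !pnatX pnat_id.
Qed.

(** Additivity reduces injectivity to a trivial kernel, and a field has no nilpotents; finiteness of
    [Kf] then gives bijectivity. *)
Lemma conj_half_bij : bijective (@conj_half F K).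
Proof.
apply: injF_bij => a b eq_ab; apply/eqP; rewrite -subr_eq0; apply/eqP.
have: conj_half (a - b) = 0.
  by apply: (addIr (conj_half b)); rewrite -conj_halfD subrK add0r.
by move/eqP; rewrite expf_eq0 => /andP[_ /eqP].
Qed.

(** Common shape of both forms: [s := id] gives [TE], [s := conj_half] gives [TH]. *)
Definition trace_form (s : Kf -> Kf) (x y : KG) : Kf :=
  Tr (\sum_(g : G) x g * s (y g)).

Lemma trace_form_self_dual (s : Kf -> Kf) (P : {linear KG -> KG}) :
    {morph s : a b / a + b} -> bijective s ->
    projector P -> is_adjoint (trace_form s) P (fun x => x - P x) ->
  self_dual (trace_form s) (P @: [set: KG]).
Proof.
move=> sD [s' sK s'K]; have s0 : s 0 = 0.
  by apply: (addrI (s 0)); rewrite -sD !addr0.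
apply: projector_self_dual => [x y z | y x z | x x0].
- rewrite /trace_form /Tr -raddfD -big_split; congr (galTrace _ _ _).
  by apply: eq_bigr => g _; rewrite ffunE sD mulrDr.
- rewrite /trace_form /Tr -raddfD -big_split; congr (galTrace _ _ _).
  by apply: eq_bigr => g _; rewrite ffunE mulrDl.
apply/ffunP=> g; rewrite ffunE; apply: Tr_nondegenerate => b.
(* Testing against the vector supported at [g] with value [s' b] isolates one coefficient: the form
   becomes [Tr (x g * b)]. *)
rewrite -(x0 [ffun h => if h == g then s' b else 0]) /trace_form.
rewrite (bigD1 g) //= ffunE eqxx s'K big1 ?addr0 // => h /negPf hg.
by rewrite ffunE hg s0 mulr0.
Qed.

End SelfDual.

Theorem proposition3p29 (F : finFieldType) (K : fieldExtType F)
    (G : finGroupType) (C : {set ext_group_alg K G})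
    (P : {linear ext_group_alg K G -> ext_group_alg K G})
    (hC : projector_code C) (hP : projector P)
    (hCP : C = P @: [set: ext_group_alg K G]) :
  (is_adjoint (@TE F K G) P (fun x => x - P x) -> self_dual (@TE F K G) C) /\
  (~~ odd (\dim {:K}) ->
   is_adjoint (@TH F K G) P (fun x => x - P x) -> self_dual (@TH F K G) C).
Proof.
rewrite hCP; split=> [|_].
  (* [TE] unfolds to [trace_form id], and [id] is its own inverse. *)
  by apply: (@trace_form_self_dual _ _ _ id) => //; exists id.
apply: (@trace_form_self_dual _ _ _ (@conj_half F K)) => //.
  exact: conj_halfD.
exact: conj_half_bij.
Qed.
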